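(* Let $A\in\mathbb{R}^{n\times n}$ be nonsingular. For $\lambda\in\mathbb{R}^L$ with $\lambda>0$ and $\mu\in\mathbb{R}^K$ with $\mu\ge0$ let $$\mathfrak{T}(\lambda,\mu)=A^{-T}\left[\tfrac14B^T\Big[\sum_\ell\lambda_\ell S_\ell\Big]^{-1}B-\sum_k\mu_kT_k\right]A^{-1}.$$ Then the problem $$\mathfrak{p}^*_\chi=\inf_{\lambda,\mu,\Theta}\left\{2\left[\phi_{\mathcal S}(\lambda)+\phi_{\mathcal T}(\mu)+\sigma^2\chi^2\mathrm{Tr}(\Theta)\right]:\ \lambda\ge0,\ \mu\ge0,\ \Theta\succeq0,\ \begin{bmatrix}\sum_\ell\lambda_\ell S_\ell&\tfrac12B\\ \tfrac12B^T&A^T\Theta A+\sum_k\mu_kT_k\end{bmatrix}\succeq0\right\}$$ reduces to a problem without matrix variables, in the following sense. For every $\lambda>0$, $\mu\ge0$, if $\mathfrak{T}(\lambda,\mu)=U\,\mathrm{Diag}\{\upsilon\}U^T$ is an eigenvalue decomposition of $\mathfrak{T}(\lambda,\mu)$, then $\Theta=U\,\mathrm{Diag}\{\upsilon^+\}U^T$ minimizes, for these $\lambda,\mu$, the objective $2\left[\phi_{\mathcal S}(\lambda)+\phi_{\mathcal T}(\mu)+\sigma^2\chi^2\mathrm{Tr}(\Theta)\right]$ over all $\Theta\succeq0$ such that $\begin{bmatrix}\sum_\ell\lambda_\ell S_\ell&\tfrac12B\\ \tfrac12B^T&A^T\Theta A+\sum_k\mu_kT_k\end{bmatrix}\succeq0$;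 and $$\mathfrak{p}^*_\chi=2\inf_{\lambda>0,\ \mu\ge0}\left\{\phi_{\mathcal S}(\lambda)+\phi_{\mathcal T}(\mu)+\sigma^2\chi^2\sum_{i=1}^n\lambda_i^+(\mathfrak{T}(\lambda,\mu))\right\}.$$
   Context: $B\in\mathbb{R}^{\nu\times n}$, $\sigma>0$ are given; $\epsilon\in(0,1)$ and $\chi=\sqrt{2\ln(2n/\epsilon)}$. $T_1,\dots,T_K$ are symmetric $n\times n$ matrices with $T_k\succeq0$, $\sum_kT_k\succ0$; $S_1,\dots,S_L$ are symmetric $\nu\times\nu$ matrices with $S_\ell\succeq0$, $\sum_\ell S_\ell\succ0$. $\mathcal T\subset\mathbb{R}^K_+$ and $\mathcal S\subset\mathbb{R}^L_+$ are convex compact sets with nonempty interiors which are monotone ($0\le t\le t'\in\mathcal T$ implies $t\in\mathcal T$, and similarly for $\mathcal S$). $\phi_{\mathcal G}(z)=\sup_{g\in\mathcal G}z^Tg$ is the support function of $\mathcal G$. Vector inequalities are entrywise; $\alpha^+=\max[\alpha,0]$, applied entrywise to vectors; $\lambda_1(Q)\ge\lambda_2(Q)\ge\dots$ are the eigenvalues of a symmetric matrix $Q$ and $\lambda_i^+(Q)=\max[\lambda_i(Q),0]$. $\Theta$ ranges over symmetric $n\times n$ matrices. *)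

(* Defs.v *)
From HB Require Import structures.
From mathcomp Require Export all_boot all_order all_algebra.
From mathcomp Require Export all_classical all_reals all_analysis.
Import Order.TTheory GRing.Theory Num.Theory.
Import numFieldTopology.Exports numFieldNormedType.Exports.

Set Implicit Arguments.
Unset Strict Implicit.
Unset Printing Implicit Defensive.

Local Open Scope classical_set_scope.
Local Open Scope ring_scope.

Definition vle (R : realType) (p : nat) (x y : 'cV[R]_p) : Prop :=
  forall i, x i ord0 <= y i ord0.

Definition vlt (R : realType) (p : nat) (x y : 'cV[R]_p) : Prop :=
  forall i, x i ord0 < y i ord0.

(* Both predicates include symmetry. *)
Definition psd (R : realType) (p : nat) (Q : 'M[R]_p) : Prop :=
  Q^T = Q /\ forall x : 'cV[R]_p, 0 <= (x^T *m Q *m x) ord0 ord0.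

Definition pd (R : realType) (p : nat) (Q : 'M[R]_p) : Prop :=
  Q^T = Q /\ forall x : 'cV[R]_p, x != 0 -> 0 < (x^T *m Q *m x) ord0 ord0.

Definition monotone_set (R : realType) (p : nat) (G : set 'cV[R]_p) : Prop :=
  forall t t' : 'cV[R]_p, vle 0 t -> vle t t' -> G t' -> G t.

(* The supremum is taken in R, where sup is 0 on empty or unbounded sets;
   support_fun is only meant for nonempty compact G. *)
Definition support_fun (R : realType) (p : nat) (G : set 'cV[R]_p)
    (z : 'cV[R]_p) : R :=
  sup [set (z^T *m g) ord0 ord0 | g in G].

Definition pencil (R : realType) (p m : nat) (Q : 'I_p -> 'M[R]_m)
    (z : 'cV[R]_p) : 'M[R]_m :=
  \sum_(i < p) z i ord0 *: Q i.

(* Eigenvalues repeated according to (algebraic) multiplicity, in nonincreasing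
   order. There is at most one such sequence, and there is one whenever Q is
   symmetric; [::] is the value for matrices without a real spectrum. *)
Definition eigenvalues (R : realType) (p : nat) (Q : 'M[R]_p) : seq R :=
  xget [::] [set s : seq R |
    sorted (fun a b : R => b <= a) s /\
    char_poly Q = \prod_(a <- s) ('X - a%:P)].

(* The index starts at 0. *)
Definition eigval (R : realType) (p : nat) (Q : 'M[R]_p) (i : 'I_p) : R :=
  (eigenvalues Q)`_i.

Definition chi (R : realType) (n : nat) (eps : R) : R :=
  Num.sqrt (2 * ln (2 * n%:R / eps)).

Definition frakT (R : realType) (nu n K L : nat) (A : 'M[R]_n)
    (B : 'M[R]_(nu, n)) (T : 'I_K -> 'M[R]_n) (S : 'I_L -> 'M[R]_nu)
    (lam : 'cV[R]_L) (mu : 'cV[R]_K) : 'M[R]_n :=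
  (invmx A)^T *m
    (4^-1 *: (B^T *m invmx (pencil S lam) *m B) - pencil T mu) *m
  invmx A.

Definition lmi (R : realType) (nu n K L : nat) (A : 'M[R]_n)
    (B : 'M[R]_(nu, n)) (T : 'I_K -> 'M[R]_n) (S : 'I_L -> 'M[R]_nu)
    (lam : 'cV[R]_L) (mu : 'cV[R]_K) (Theta : 'M[R]_n) : Prop :=
  psd (block_mx (pencil S lam) (2^-1 *: B)
                (2^-1 *: B^T) (A^T *m Theta *m A + pencil T mu)).

Definition objective (R : realType) (n K L : nat) (calT : set 'cV[R]_K)
    (calS : set 'cV[R]_L) (sigma eps : R)
    (lam : 'cV[R]_L) (mu : 'cV[R]_K) (Theta : 'M[R]_n) : R :=
  2 * (support_fun calS lam + support_fun calT mu
       + sigma ^+ 2 * chi n eps ^+ 2 * \tr Theta).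

Definition pstar (R : realType) (nu n K L : nat) (A : 'M[R]_n)
    (B : 'M[R]_(nu, n)) (T : 'I_K -> 'M[R]_n) (S : 'I_L -> 'M[R]_nu)
    (calT : set 'cV[R]_K) (calS : set 'cV[R]_L) (sigma eps : R) : \bar R :=
  ereal_inf [set v : \bar R |
    exists (lam : 'cV[R]_L) (mu : 'cV[R]_K) (Theta : 'M[R]_n),
      [/\ vle 0 lam, vle 0 mu, psd Theta, lmi A B T S lam mu Theta
        & v = (objective calT calS sigma eps lam mu Theta)%:E]].

(* Main.v *)
Require Import Defs.
From mathcomp Require Import all_boot all_order all_algebra.
From mathcomp Require Import all_classical all_reals all_analysis.
From mathcomp Require Import complex lra.
Import Order.TTheory GRing.Theory Num.Theory.
Import numFieldTopology.Exports numFieldNormedType.Exports.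
Local Open Scope classical_set_scope.
Local Open Scope ring_scope.

(** The matrix variable is eliminated by a Schur complement.  When
    [lam > 0], the pencil [pencil S lam] is positive definite ([pencil_pd]), so
    the linear matrix inequality says that
    [A^T Theta A + pencil T mu - B^T (pencil S lam)^-1 B / 4] is positive
    semidefinite, and the congruence by [A^-1] turns this into
    [Theta >= frakT] in the Loewner order ([lmiP]).  The objective depends on
    [Theta] only through a nonnegative multiple of its trace.  In an
    orthonormal eigenbasis of [frakT], the [i]-th diagonal entry of any
    feasible [Theta] is at least the [i]-th eigenvalue of [frakT] and at least
    [0], hence at least their maximum ([trace_ge_pos_part]); the positive part
    of [frakT] is feasible and attains all these bounds simultaneously
    ([pos_part_optimal]).

    For the optimal values, the spectral theorem for real symmetric matrices
    ([sym_diagonalization]) provides the eigenbasis and identifies the sum of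
    positive parts with the one over the sorted roots of the characteristic
    polynomial ([sum_eigval_orth_diag]).  It remains to pass from [lam >= 0] to
    [lam > 0].  Moving a feasible [lam] to [lam + d * (1, ..., 1)] preserves
    feasibility with the same [mu] and [Theta] ([lmi_add1]), while sublinearity
    of the support function ([support_fun_perturb]) bounds the increase of the
    objective by a constant times [d], and [d] is arbitrarily small. *)

Set Implicit Arguments.
Unset Strict Implicit.

(** * Positive semidefinite matrices and the Schur complement *)

Lemma psd_add (R : realType) (p : nat) (P Q : 'M[R]_p) :
  psd P -> psd Q -> psd (P + Q).
Proof.
move=> [Ps Pp] [Qs Qp]; split; first by rewrite linearD /= Ps Qs.
by move=> x; rewrite mulmxDr mulmxDl mxE addr_ge0.
Qed.

Lemma psd_congr (R : realType) (m p : nat) (Q : 'M[R]_m) (P : 'M[R]_(m, p)) :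
  psd Q -> psd (P^T *m Q *m P).
Proof.
move=> [Qs Qp]; split; first by rewrite !trmx_mul trmxK Qs mulmxA.
by move=> x; have := Qp (P *m x); rewrite trmx_mul !mulmxA.
Qed.

Lemma psd_congr_unit (R : realType) (p : nat) (Q A : 'M[R]_p) :
  A \in unitmx -> psd (A^T *m Q *m A) <-> psd Q.
Proof.
move=> Au; split=> [/(psd_congr (invmx A))|]; last exact: psd_congr.
by rewrite trmx_inv !mulmxA mulVmx ?unitmx_tr// mul1mx mulmxK.
Qed.

Lemma psd_scale (R : realType) (p : nat) (a : R) (Q : 'M[R]_p) :
  0 <= a -> psd Q -> psd (a *: Q).
Proof.
move=> a0 [Qs Qp]; split; first by rewrite linearZ /= Qs.
by move=> x; rewrite -scalemxAr -scalemxAl mxE mulr_ge0.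
Qed.

Lemma psd_diag_ge0 (R : realType) (p : nat) (Q : 'M[R]_p) (i : 'I_p) :
  psd Q -> 0 <= Q i i.
Proof.
move=> [_ /(_ (delta_mx i ord0))].
by rewrite trmx_delta -rowE -colE !mxE.
Qed.

Lemma psd_diag_mx (R : realType) (p : nat) (d : 'rV[R]_p) :
  (forall i, 0 <= d ord0 i) -> psd (diag_mx d).
Proof.
move=> d0; split; first exact: tr_diag_mx.
move=> x; rewrite mxE sumr_ge0// => i _.
by rewrite mul_mx_diag !mxE mulrAC -expr2 mulr_ge0 ?sqr_ge0.
Qed.

Lemma pd_psd (R : realType) (p : nat) (P : 'M[R]_p) : pd P -> psd P.
Proof.
move=> [Ps Pp]; split=> // x; have [->|/Pp/ltW//] := eqVneq x 0.
by rewrite mulmx0 mxE.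
Qed.

Lemma pd_unit (R : realType) (p : nat) (P : 'M[R]_p) : pd P -> P \in unitmx.
Proof.
move=> [Ps Pp]; rewrite -row_free_unit; apply: inj_row_free => v vP0.
have [/eqP|vT0] := eqVneq v^T 0; first by rewrite trmx_eq0 => /eqP.
by have := Pp _ vT0; rewrite trmxK vP0 mul0mx mxE ltxx.
Qed.

(** With [P] invertible, the block matrix is the sum of the congruence of [P] by
    [row_mx 1 (P^-1 Q)] and of that of the Schur complement by [row_mx 0 1];
    conversely, the congruence by [col_mx (- P^-1 Q) 1] isolates the Schur
    complement. *)
Lemma psd_schur (R : realType) (m p : nat) (P : 'M[R]_m) (Q : 'M[R]_(m, p))
    (W : 'M[R]_p) :
  pd P ->
  psd (block_mx P Q Q^T W) <-> psd (W - Q^T *m invmx P *m Q).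
Proof.
move=> Ppd; have Pu := pd_unit Ppd; have [Ps _] := Ppd.
have iPs : (invmx P)^T = invmx P by rewrite trmx_inv Ps.
split=> [/(psd_congr (col_mx (- (invmx P *m Q)) 1%:M))|Zpsd].
  rewrite tr_col_mx mul_row_block mul_row_col [(- _)^T]linearN /=.
  rewrite trmx_mul iPs trmx1 mul1mx !mulNmx mulmxKV// addNr mul0mx add0r.
  rewrite mulmx1 mul1mx.
  by rewrite addrC.
have -> : block_mx P Q Q^T W =
    (row_mx 1%:M (invmx P *m Q))^T *m P *m row_mx 1%:M (invmx P *m Q)
    + (row_mx 0 1%:M)^T *m (W - Q^T *m invmx P *m Q) *m row_mx 0 1%:M.
  rewrite !tr_row_mx [col_mx _ _ *m P]mul_col_mx
    [col_mx _ _ *m (W - _)]mul_col_mx !mul_col_row add_block_mx.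
  rewrite trmx_mul iPs !trmx1 trmx0 !mul1mx !mul0mx !mulmx0 !mulmx1 !addr0.
  by rewrite mulKVmx// mulmxKV// mulmxA addrC subrK.
by apply: psd_add; apply: psd_congr => //; apply: pd_psd.
Qed.

(** * Matrix pencils and the linear matrix inequality *)

Lemma quad_pencil (R : realType) (p m : nat) (Q : 'I_p -> 'M[R]_m)
    (z : 'cV[R]_p) (x : 'cV[R]_m) :
  (x^T *m pencil Q z *m x) ord0 ord0 =
  \sum_(i < p) z i ord0 * (x^T *m Q i *m x) ord0 ord0.
Proof.
rewrite mulmx_sumr mulmx_suml summxE; apply: eq_bigr => i _.
by rewrite -scalemxAr -scalemxAl mxE.
Qed.

Lemma tr_pencil (R : realType) (p m : nat) (Q : 'I_p -> 'M[R]_m)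
    (z : 'cV[R]_p) :
  (forall i, psd (Q i)) -> (pencil Q z)^T = pencil Q z.
Proof.
move=> Qp; rewrite linear_sum; apply: eq_bigr => i _.
by rewrite linearZ /= (proj1 (Qp i)).
Qed.

Lemma pencil_const1 (R : realType) (p m : nat) (Q : 'I_p -> 'M[R]_m) :
  pencil Q (const_mx 1) = \sum_(i < p) Q i.
Proof. by apply: eq_bigr => i _; rewrite mxE scale1r. Qed.

(** All coefficients are positive and all terms of the quadratic form are
    nonnegative: if it vanishes at [x], then so does each term, hence also the
    quadratic form of the sum of the [Q i]. *)
Lemma pencil_pd (R : realType) (p m : nat) (Q : 'I_p -> 'M[R]_m)
    (z : 'cV[R]_p) :
  (forall i, psd (Q i)) -> pd (\sum_(i < p) Q i) -> vlt 0 z ->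
  pd (pencil Q z).
Proof.
move=> Qp [_ sQp] z0; split=> [|x x0]; first exact: tr_pencil.
have zp i : 0 < z i ord0 by have := z0 i; rewrite mxE.
have q0 i : true -> 0 <= z i ord0 * (x^T *m Q i *m x) ord0 ord0.
  by move=> _; apply: mulr_ge0; [exact: ltW | exact: (proj2 (Qp i))].
rewrite quad_pencil lt_neqAle sumr_ge0// andbT eq_sym.
apply: contraTN (sQp _ x0) => /eqP/(psumr_eq0P q0) all0.
rewrite -pencil_const1 quad_pencil big1 ?ltxx// => i _.
by have /eqP := all0 i isT; rewrite mulf_eq0 gt_eqF//= => /eqP->; rewrite mulr0.
Qed.

Lemma pencilD (R : realType) (p m : nat) (Q : 'I_p -> 'M[R]_m)
    (y z : 'cV[R]_p) : pencil Q (y + z) = pencil Q y + pencil Q z.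
Proof.
by rewrite -big_split; apply: eq_bigr => i _; rewrite mxE scalerDl.
Qed.

(** Congruence by the invertible matrix [A] maps [Theta - frakT A B T S lam mu]
    to the Schur complement of the block matrix. *)
Lemma lmiP (R : realType) (nu n K L : nat) (A : 'M[R]_n) (B : 'M[R]_(nu, n))
    (T : 'I_K -> 'M[R]_n) (S : 'I_L -> 'M[R]_nu)
    (lam : 'cV[R]_L) (mu : 'cV[R]_K) (Theta : 'M[R]_n) :
  A \in unitmx -> pd (pencil S lam) ->
  lmi A B T S lam mu Theta <-> psd (Theta - frakT A B T S lam mu).
Proof.
move=> Au Spd.
have -> : lmi A B T S lam mu Theta =
  psd (block_mx (pencil S lam) (2^-1 *: B)
                (2^-1 *: B)^T (A^T *m Theta *m A + pencil T mu)).
  by rewrite /lmi linearZ.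
rewrite psd_schur// -[X in _ <-> X](psd_congr_unit _ Au).
set X := (X in psd X); set Y := (Y in _ <-> psd Y).
suff -> : X = Y by [].
have conjK (M : 'M[R]_n) : A^T *m ((invmx A)^T *m M *m invmx A) *m A = M.
  by rewrite trmx_inv !mulmxA mulmxV ?unitmx_tr// mul1mx mulmxKV.
rewrite /X /Y /frakT mulmxBr mulmxBl conjK.
rewrite opprB addrA; congr (_ - _).
rewrite [(_ *: B)^T]linearZ /= -!scalemxAl -!scalemxAr scalerA; congr (_ *: _).
by rewrite -invfM -natrM.
Qed.

(** * Matrices diagonalized in an orthonormal basis *)

Section OrthogonalDiagonal.
Context (R : realType) (n : nat) (U : 'M[R]_n) (ups : 'rV[R]_n).
Context (Uo : U^T *m U = 1%:M).

Lemma mxtrace_orth_conj (Q : 'M[R]_n) : \tr (U^T *m Q *m U) = \tr Q.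
Proof. by rewrite -mulmxA mxtrace_mulC -mulmxA (mulmx1C Uo) mulmx1. Qed.

Lemma mxtrace_orth_diag : \tr (U *m diag_mx ups *m U^T) = \sum_i ups ord0 i.
Proof. by rewrite mxtrace_mulC mulmxA Uo mul1mx mxtrace_diag. Qed.

Lemma psd_orth_diag :
  (forall i, 0 <= ups ord0 i) -> psd (U *m diag_mx ups *m U^T).
Proof.
by move=> /psd_diag_mx /(psd_congr U^T); rewrite trmxK.
Qed.

(** The trace of [Q] is the sum of its diagonal entries in the basis [U], and
    each of them is bounded below by both [0] and the corresponding [ups i]. *)
Lemma trace_ge_pos_part (Q : 'M[R]_n) :
  psd Q -> psd (Q - U *m diag_mx ups *m U^T) ->
  \sum_i Num.max (ups ord0 i) 0 <= \tr Q.
Proof.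
move=> /(psd_congr U) Q0 /(psd_congr U) Q1.
rewrite -mxtrace_orth_conj; apply: ler_sum => i _.
rewrite ge_max (psd_diag_ge0 i Q0) andbT -subr_ge0.
have := psd_diag_ge0 i Q1.
rewrite mulmxBr mulmxBl !mulmxA Uo mul1mx -[X in _ - X]mulmxA Uo mulmx1.
by rewrite !mxE eqxx mulr1n.
Qed.

Lemma char_poly_orth_diag :
  char_poly (U *m diag_mx ups *m U^T) = \prod_i ('X - (ups ord0 i)%:P).
Proof.
have -> : \prod_i ('X - (ups ord0 i)%:P) = char_poly (diag_mx ups).
  rewrite char_poly_trig ?diag_mx_is_trig//.
  by apply: eq_bigr => i _; rewrite mxE eqxx mulr1n.
pose V := map_mx polyC U.
have VV : V *m V^T = 1%:M.
  by rewrite /V map_trmx -map_mxM (mulmx1C Uo) map_mx1.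
have detV : \det V * \det V^T = 1 by rewrite -det_mulmx VV det1.
have VXV : V *m 'X%:M *m V^T = 'X%:M.
  by rewrite scalar_mxC -mulmxA VV mulmx1.
rewrite /char_poly -[RHS]mulr1 -detV mulrCA mulrA -!det_mulmx /char_poly_mx.
by rewrite mulmxBr mulmxBl VXV !map_mxM -map_trmx.
Qed.

(** The entries of [ups] and the sequence of eigenvalues are the roots of the
    same split monic polynomial, so they agree up to a permutation. *)
Lemma sum_eigval_orth_diag (f : R -> R) :
  \sum_i f (eigval (U *m diag_mx ups *m U^T) i) = \sum_i f (ups ord0 i).
Proof.
set Q := U *m _ *m _.
pose geR := fun a b : R => b <= a.
have geT : total geR by move=> a b; exact: le_total.
pose s0 := [seq ups ord0 i | i <- enum 'I_n].
have prod_s0 : char_poly Q = \prod_(a <- s0) ('X - a%:P).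
  by rewrite char_poly_orth_diag big_map big_enum.
have [_ prod_s] : sorted geR (eigenvalues Q) /\
    char_poly Q = \prod_(a <- eigenvalues Q) ('X - a%:P).
  (* Sorting the entries of ups shows that the set chosen from is nonempty. *)
  rewrite /eigenvalues; case: xgetP => [s _ //|/(_ (sort geR s0))[]].
  split; first exact: sort_sorted.
  by rewrite prod_s0; apply: perm_big; rewrite perm_sym perm_sort.
have s0E : perm_eq (eigenvalues Q) s0.
  by apply: prod_XsubC_eq; rewrite -prod_s -prod_s0.
have sz : size (eigenvalues Q) = n.
  by rewrite (perm_size s0E) size_map size_enum_ord.
transitivity (\sum_(a <- eigenvalues Q) f a).
  by rewrite (big_nth 0) sz big_mkord.
by rewrite (perm_big _ s0E) big_map big_enum.
Qed.

End OrthogonalDiagonal.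

(** * Support functions *)

(** Sublinearity of the support function; compactness and nonemptiness make the
    suprema genuine. *)
Lemma support_fun_perturb (R : realType) (p : nat) (G : set 'cV[R]_p)
    (y z : 'cV[R]_p) (d : R) :
  compact G -> G !=set0 -> 0 <= d ->
  support_fun G (y + d *: z) <= support_fun G y + d * support_fun G z.
Proof.
move=> Gc [g0 Gg0] d0.
have bnd (x : 'cV[R]_p) : has_ubound [set (x^T *m g) ord0 ord0 | g in G].
  have [M [_ HM]] := compact_bounded Gc.
  have {}HM := HM (M + 1) (ltr_pwDr ltr01 (lexx M)).
  exists (\sum_i `|x i ord0| * (M + 1)) => _ [g /HM gM <-].
  rewrite mxE; apply: ler_sum => i _.
  rewrite (le_trans (ler_norm _))// normrM mxE ler_wpM2l//.
  apply: le_trans gM; rewrite [leRHS]mx_normrE.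
  exact: (@le_bigmax _ _ _ 0
    (fun ij : 'I_p * 'I_1 => `|g ij.1 ij.2|) (i, ord0)).
apply: ge_sup; first by eexists; exists g0.
move=> _ [g Gg <-].
have le_sf (x : 'cV[R]_p) : (x^T *m g) ord0 ord0 <= support_fun G x.
  by apply: ub_le_sup => //; exists g.
rewrite [(y + _)^T]linearD /= linearZ /= mulmxDl -scalemxAl mxE [X in _ + X]mxE.
by rewrite lerD ?ler_wpM2l.
Qed.

(** * The spectral theorem for real symmetric matrices *)

(** Seen as a complex matrix, [Q] is Hermitian, so it is unitarily
    diagonalizable with a real diagonal; being an eigenvalue descends along the
    embedding of [R] into [R[i]]. *)
Lemma sym_eigenvalue (R : realType) (n : nat) (Q : 'M[R]_n.+1) :
  Q^T = Q -> exists a, eigenvalue Q a.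
Proof.
move=> Qs; pose f : R -> R[i] := real_complex R.
pose QC : 'M[R[i]]_n.+1 := map_mx f Q.
have QCr : QC \is a mxOver Num.real.
  by apply/mxOverP => i j; rewrite mxE; apply/complex_realP; exists (Q i j).
have QCs : QC \is symmetricmx.
  apply/is_hermitianmxP.
  by rewrite expr0 scale1r map_mx_id// map_trmx Qs.
have QCh := realsym_hermsym QCs QCr.
have /mxOverP/(_ ord0 ord0)/complex_realP[a da] :=
  hermitian_spectral_diag_real QCh.
have /orthomx_spectralP QCE := hermitian_normalmx QCh.
exists a; rewrite -(eigenvalue_map f) -/QC.
have Pu := spectral_unit QC; move: Pu da QCE.
move: (spectralmx QC) (spectral_diag QC) => P d Pu da QCE.
apply/eigenvalueP; exists (row ord0 P).
  by rewrite QCE -row_mul !mulmxA mulmxV// mul1mx row_mul row_diag_mx da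
             -scalemxAl -rowE.
apply: contraTneq Pu => P0; rewrite -row_free_unit -kermx_eq0.
apply/negP => /eqP K0.
have /sub_kermxP : delta_mx (0 : 'I_1) ord0 *m P = 0 by rewrite -rowE.
rewrite K0 submx0 => /eqP/matrixP/(_ 0 ord0)/eqP.
by rewrite !mxE !eqxx oner_eq0.
Qed.

Lemma sqnorm_ge0 (R : realType) (p : nat) (x : 'cV[R]_p) :
  0 <= (x^T *m x) ord0 ord0.
Proof. by rewrite mxE sumr_ge0// => i _; rewrite mxE -expr2 sqr_ge0. Qed.

Lemma sqnorm_eq0 (R : realType) (p : nat) (x : 'cV[R]_p) :
  (x^T *m x) ord0 ord0 = 0 -> x = 0.
Proof.
rewrite mxE => /psumr_eq0P x0; apply/colP => i; apply/eqP.
have := x0 _ i isT; rewrite !mxE => /(_ _)/eqP.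
rewrite mulf_eq0 orbb; apply => k _.
by rewrite mxE -expr2 sqr_ge0.
Qed.

(** A unit vector is the first column of an orthogonal matrix: if it is not the
    first basis vector [e], take the Householder reflection that exchanges [v]
    and [e]. *)
Lemma householder (R : realType) (n : nat) (v : 'cV[R]_n.+1) :
  v^T *m v = 1%:M ->
  exists2 H : 'M[R]_n.+1, H^T *m H = 1%:M & col ord0 H = v.
Proof.
move=> vv; pose e : 'cV[R]_n.+1 := delta_mx ord0 ord0.
have ee : e^T *m e = 1%:M.
  apply/matrixP => i j; rewrite !ord1 /e trmx_delta mul_delta_mx.
  by rewrite !mxE !eqxx.
have [->|ve] := eqVneq v e.
  by exists 1%:M; [rewrite trmx1 mulmx1 | rewrite colE mul1mx].
pose w := v - e; pose c := (v^T *m e) ord0 ord0.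
have ve_c : v^T *m e = c%:M by rewrite [LHS]mx11_scalar.
have ev_c : e^T *m v = c%:M.
  by rewrite -[LHS]trmxK trmx_mul trmxK ve_c tr_scalar_mx.
have we : w^T *m e = (c - 1)%:M.
  by rewrite /w [(v - e)^T]linearB /= mulmxBl ve_c ee raddfB.
have ww : w^T *m w = (2 * (1 - c))%:M.
  rewrite /w [(v - e)^T]linearB /= mulmxBl !mulmxBr vv ee ve_c ev_c -!raddfB /=.
  by congr (_%:M); rewrite opprB mulr_natl mulr2n.
have c1 : 1 - c != 0.
  apply: contra_neq ve => c0; apply: subr0_eq; apply: sqnorm_eq0.
  by rewrite ww c0 mulr0 !mxE.
(* As |w|^2 = 2 (1 - c), this is the reflection 1 - 2 w w^T / |w|^2. *)
pose H : 'M[R]_n.+1 := 1%:M - (1 - c)^-1 *: (w *m w^T).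
have Hs : H^T = H by rewrite /H linearB /= linearZ /= trmx_mul trmxK trmx1.
have Hw : H *m w = - w.
  rewrite mulmxBl mul1mx -scalemxAl -mulmxA ww mul_mx_scalar scalerA.
  by rewrite mulrCA mulVf// mulr1 scaler_nat mulr2n opprD addNKr.
exists H; last first.
  rewrite colE -/e mulmxBl mul1mx -scalemxAl -mulmxA we mul_mx_scalar scalerA.
  by rewrite -(opprB 1 c) mulrN mulVf// scaleN1r opprK addrC subrK.
rewrite Hs {2}/H mulmxBr mulmx1 -scalemxAr mulmxA Hw mulNmx scalerN opprK.
by rewrite /H subrK.
Qed.

(** Induction on the dimension: in an orthonormal basis whose first vector is a
    unit eigenvector, a symmetric matrix is block diagonal, with a symmetric
    lower right block of smaller size. *)
Theorem sym_diagonalization (R : realType) (n : nat) (Q : 'M[R]_n) :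
  Q^T = Q ->
  exists (U : 'M[R]_n) (ups : 'rV[R]_n),
    U^T *m U = 1%:M /\ Q = U *m diag_mx ups *m U^T.
Proof.
elim: n Q => [|n IH] Q Qs.
  by exists 1%:M, 0; split; apply/matrixP => -[].
have [a /eigenvalueP[u uQ u0]] := sym_eigenvalue Qs.
pose r := (u *m u^T) ord0 ord0.
have uu : u *m u^T = r%:M by rewrite [LHS]mx11_scalar.
have r0 : 0 < r.
  have rE : r = (u^T^T *m u^T) ord0 ord0 by rewrite trmxK.
  rewrite lt_neqAle eq_sym {2}rE sqnorm_ge0 andbT.
  apply: contra_neq u0; rewrite rE => /sqnorm_eq0/(congr1 trmx).
  by rewrite trmxK trmx0.
pose v := (Num.sqrt r)^-1 *: u^T.
have vv : v^T *m v = 1%:M.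
  rewrite /v [(_ *: u^T)^T]linearZ /= trmxK -scalemxAl -scalemxAr uu scalerA.
  rewrite scale_scalar_mx -invfM -expr2 sqr_sqrtr ?ltW//.
  by rewrite mulVf ?gt_eqF.
have Qv : Q *m v = a *: v.
  rewrite /v -scalemxAr -{1}Qs -trmx_mul uQ linearZ /= !scalerA.
  by rewrite mulrC.
have [H HH Hv] := householder vv.
pose M : 'M[R]_(1 + n) := H^T *m Q *m H.
have Ms : M^T = M by rewrite /M !trmx_mul trmxK Qs mulmxA.
have Mcol : col ord0 M = a *: delta_mx ord0 ord0.
  rewrite colE /M -!mulmxA -colE Hv Qv -Hv colE -scalemxAr mulmxA HH.
  by rewrite mul1mx.
have QE : Q = H *m M *m H^T.
  by rewrite /M !mulmxA (mulmx1C HH) mul1mx -mulmxA (mulmx1C HH) mulmx1.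
clearbody M.
have Mul : ulsubmx M = a%:M.
  apply/matrixP => i j; rewrite !ord1.
  have /matrixP/(_ ord0 ord0) := Mcol; rewrite !mxE !eqxx mulr1 => <-.
  by congr (M _ _); apply/val_inj.
have Mdl : dlsubmx M = 0.
  apply/matrixP => i j; rewrite ord1.
  have /matrixP/(_ (rshift 1 i) ord0) := Mcol; rewrite !mxE mulr0 => <-.
  by congr (M _ _); apply/val_inj.
have Mur : ursubmx M = 0 by rewrite -[LHS]trmxK trmx_ursub Ms Mdl trmx0.
have [V [d [VV dE]]] : exists (V : 'M[R]_n) (d : 'rV[R]_n),
    V^T *m V = 1%:M /\ drsubmx M = V *m diag_mx d *m V^T.
  by apply: IH; rewrite trmx_drsub Ms.
have ME : M = block_mx a%:M 0 0 (V *m diag_mx d *m V^T).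
  by rewrite -[LHS]submxK Mul Mdl Mur dE.
pose W : 'M[R]_(1 + n) := block_mx 1%:M 0 0 V.
have WW : W^T *m W = 1%:M.
  rewrite tr_block_mx mulmx_block !trmx0 trmx1 VV !mul0mx !mulmx0 !mulmx1.
  by rewrite !addr0 !add0r -scalar_mx_block.
have MW : M = W *m diag_mx (row_mx a%:M d) *m W^T.
  rewrite ME /W diag_mx_row tr_block_mx !mulmx_block.
  rewrite !trmx0 trmx1 !mul0mx !mulmx0 !mulmx1 !mul1mx !addr0 !add0r !mul0mx.
  congr (block_mx _ _ _ _).
  by apply/matrixP => i j; rewrite !ord1 !mxE eqxx.
exists (H *m W), (row_mx a%:M d); split.
  by rewrite trmx_mul mulmxA -[_ *m H^T *m _]mulmxA HH mulmx1 WW.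
by rewrite QE MW trmx_mul !mulmxA.
Qed.

(** * The reduced problem *)

Lemma frakT_sym (R : realType) (nu n K L : nat) (A : 'M[R]_n)
    (B : 'M[R]_(nu, n)) (T : 'I_K -> 'M[R]_n) (S : 'I_L -> 'M[R]_nu)
    (lam : 'cV[R]_L) (mu : 'cV[R]_K) :
  (forall k, psd (T k)) -> (forall l, psd (S l)) ->
  (frakT A B T S lam mu)^T = frakT A B T S lam mu.
Proof.
move=> Tp Sp; rewrite /frakT; set M := _ - pencil T mu.
have Ms : M^T = M.
  rewrite /M [LHS]linearB /= [(_ *: _)^T]linearZ /=.
  by rewrite !trmx_mul trmxK trmx_inv !tr_pencil// mulmxA.
by rewrite !trmx_mul trmxK Ms mulmxA.
Qed.

(** The block matrix grows by [d *: \sum_l S l] in its upper left block, which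
    is a congruence of a positive semidefinite matrix. *)
Lemma lmi_add1 (R : realType) (nu n K L : nat) (A : 'M[R]_n)
    (B : 'M[R]_(nu, n)) (T : 'I_K -> 'M[R]_n) (S : 'I_L -> 'M[R]_nu)
    (lam : 'cV[R]_L) (mu : 'cV[R]_K) (Theta : 'M[R]_n) (d : R) :
  psd (\sum_(l < L) S l) -> 0 <= d ->
  lmi A B T S lam mu Theta ->
  lmi A B T S (lam + d *: const_mx 1) mu Theta.
Proof.
move=> Sp d0; rewrite /lmi pencilD => lmiQ.
have -> : pencil S (d *: const_mx 1) = d *: \sum_(l < L) S l.
  rewrite -pencil_const1 scaler_sumr; apply: eq_bigr => l _.
  by rewrite !mxE mulr1 scale1r.
have := psd_add lmiQ (psd_congr (row_mx 1%:M 0) (psd_scale d0 Sp)).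
rewrite tr_row_mx mul_col_mx mul_col_row trmx1 trmx0 !mul0mx !mul1mx.
by rewrite !mulmx0 mulmx1 add_block_mx !addr0.
Qed.

(** [Theta] is feasible because [max a 0] dominates both [a] and [0], and its
    trace equals the lower bound of [trace_ge_pos_part]. *)
Lemma pos_part_optimal (R : realType) (nu n K L : nat) (A : 'M[R]_n)
    (B : 'M[R]_(nu, n)) (T : 'I_K -> 'M[R]_n) (S : 'I_L -> 'M[R]_nu)
    (lam : 'cV[R]_L) (mu : 'cV[R]_K) (U : 'M[R]_n) (ups : 'rV[R]_n) :
  A \in unitmx -> pd (pencil S lam) -> U^T *m U = 1%:M ->
  frakT A B T S lam mu = U *m diag_mx ups *m U^T ->
  let Theta := U *m diag_mx (map_mx (fun a : R => Num.max a 0) ups) *m U^T in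
  [/\ psd Theta, lmi A B T S lam mu Theta,
      \tr Theta = \sum_(i < n) Num.max (eigval (frakT A B T S lam mu) i) 0
    & forall Theta' : 'M[R]_n,
        psd Theta' -> lmi A B T S lam mu Theta' -> \tr Theta <= \tr Theta'].
Proof.
move=> Au Spd UU TE Theta.
have trE : \tr Theta = \sum_i Num.max (ups ord0 i) 0.
  by rewrite mxtrace_orth_diag//; apply: eq_bigr => i _; rewrite mxE.
split.
- by apply: psd_orth_diag => i; rewrite mxE le_max lexx orbT.
- apply/lmiP => //; rewrite TE -mulmxBl -mulmxBr -raddfB /=.
  by apply: psd_orth_diag => i; rewrite !mxE subr_ge0 le_max lexx.
- by rewrite TE (sum_eigval_orth_diag _ UU (fun a => Num.max a 0)).
- move=> Q Qp /(lmiP _ _ _ _ Au Spd).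
  by rewrite TE trE; apply: trace_ge_pos_part.
Qed.

Lemma objective_min (R : realType) (nu n K L : nat)
    (B : 'M[R]_(nu, n)) (sigma eps : R)
    (T : 'I_K -> 'M[R]_n) (S : 'I_L -> 'M[R]_nu)
    (calT : set 'cV[R]_K) (calS : set 'cV[R]_L) (A : 'M[R]_n)
    (lam : 'cV[R]_L) (mu : 'cV[R]_K) :
  A \in unitmx -> (forall k, psd (T k)) -> (forall l, psd (S l)) ->
  pd (pencil S lam) ->
  let m := 2 * (support_fun calS lam + support_fun calT mu
    + sigma ^+ 2 * chi n eps ^+ 2
      * \sum_(i < n) Num.max (eigval (frakT A B T S lam mu) i) 0) in
  (exists Theta, [/\ psd Theta, lmi A B T S lam mu Theta
    & objective calT calS sigma eps lam mu Theta = m]) /\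
  (forall Theta, psd Theta -> lmi A B T S lam mu Theta ->
    m <= objective calT calS sigma eps lam mu Theta).
Proof.
move=> Au Tp Sp Spd m.
have [U [ups [UU TE]]] := sym_diagonalization (frakT_sym A B lam mu Tp Sp).
have [Pp Pl Ptr Pmin] := pos_part_optimal Au Spd UU TE.
split=> [|Q Qp Ql].
  by eexists; split; [exact: Pp | exact: Pl | rewrite /objective Ptr].
rewrite /objective /m -Ptr ler_pM2l// lerD2l.
by apply: ler_wpM2l (Pmin _ Qp Ql); rewrite mulr_ge0 ?sqr_ge0.
Qed.

Unset Implicit Arguments.

Theorem mainTheorem5 (R : realType) (nu n K L : nat)
    (B : 'M[R]_(nu, n)) (sigma eps : R)
    (T : 'I_K -> 'M[R]_n) (S : 'I_L -> 'M[R]_nu)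
    (calT : set 'cV[R]_K) (calS : set 'cV[R]_L) (A : 'M[R]_n)
    (sigma_gt0 : 0 < sigma) (eps_gt0 : 0 < eps) (eps_lt1 : eps < 1)
    (T_psd : forall k, psd (T k)) (T_pd : pd (\sum_(k < K) T k))
    (S_psd : forall l, psd (S l)) (S_pd : pd (\sum_(l < L) S l))
    (calT_ge0 : forall t, calT t -> vle 0 t)
    (calT_convex : convex_set (calT : set (convex_lmodType 'cV[R]_K)))
    (calT_compact : compact calT) (calT_int : interior calT !=set0)
    (calT_monotone : monotone_set calT)
    (calS_ge0 : forall s, calS s -> vle 0 s)
    (calS_convex : convex_set (calS : set (convex_lmodType 'cV[R]_L)))
    (calS_compact : compact calS) (calS_int : interior calS !=set0)
    (calS_monotone : monotone_set calS)
    (A_nonsing : A \in unitmx) :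
  (forall (lam : 'cV[R]_L) (mu : 'cV[R]_K) (U : 'M[R]_n) (ups : 'rV[R]_n),
     vlt 0 lam -> vle 0 mu ->
     U^T *m U = 1%:M ->
     frakT A B T S lam mu = U *m diag_mx ups *m U^T ->
     let Theta := U *m diag_mx (map_mx (fun a : R => Num.max a 0) ups) *m U^T in
     [/\ psd Theta, lmi A B T S lam mu Theta
       & forall Theta' : 'M[R]_n,
           psd Theta' -> lmi A B T S lam mu Theta' ->
           objective calT calS sigma eps lam mu Theta
             <= objective calT calS sigma eps lam mu Theta'])
  /\
  pstar A B T S calT calS sigma eps =
  (2%:E * ereal_inf [set v : \bar R |
    (exists (lam : 'cV[R]_L) (mu : 'cV[R]_K),
      [/\ vlt 0 lam, vle 0 mu
        & v = (support_fun calS lam + support_fun calT mu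
               + sigma ^+ 2 * chi n eps ^+ 2
                 * \sum_(i < n) Num.max (eigval (frakT A B T S lam mu) i) 0)%:E])%R])%E.
Proof.
split=> [lam mu U ups lam0 _ UU TE Theta|].
  have Spd := pencil_pd S_psd S_pd lam0.
  have [Tp Tl _ Tmin] := pos_part_optimal A_nonsing Spd UU TE.
  split=> // Q Qp Ql; rewrite /objective ler_pM2l// lerD2l.
  by apply: ler_wpM2l (Tmin _ Qp Ql); rewrite mulr_ge0 ?sqr_ge0.
have min_at lam mu (lam0 : vlt 0 lam) := objective_min B sigma eps calT calS mu
  A_nonsing T_psd S_psd (pencil_pd S_psd S_pd lam0).
apply/eqP; rewrite eq_le; apply/andP; split.
  rewrite -ereal_inf_pZl//.
  apply: le_ereal_inf_tmp => _ [w [lam [mu [lam0 mu0 ->]]] <-].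
  apply: ereal_inf_lbound.
  have [[Q [Qp Ql Qv]] _] := min_at lam mu lam0.
  exists lam, mu, Q; split => //; last by rewrite Qv EFinM.
  by move=> l; exact: ltW.
apply: le_ereal_inf_tmp => _ [lam [mu [Q [lam0 mu0 Qp Ql ->]]]].
apply/lee_addgt0Pr => e e0.
have calS0 : calS !=set0.
  by case: calS_int => s /interior_subset calSs; exists s.
pose phi1 := support_fun calS (const_mx 1).
(* The perturbation costs at most 2 * d * phi1 <= e; the absolute value and the
   added 1 make the denominator positive. *)
pose d := e / (2 * (`|phi1| + 1)).
have n0 : 0 < `|phi1| + 1 by rewrite ltr_wpDl.
have d0 : 0 < d by rewrite divr_gt0// mulr_gt0.
pose lam' := lam + d *: const_mx 1 : 'cV[R]_L.
have lam'0 : vlt 0 lam'.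
  by move=> l; rewrite !mxE mulr1 ltr_wpDl//; have := lam0 l; rewrite mxE.
have Ql' := lmi_add1 (pd_psd S_pd) (ltW d0) Ql.
have [_ /(_ _ Qp Ql')] := min_at lam' mu lam'0.
set m := (_ + _ * \sum_(i < n) _) => m_le.
apply: (@le_trans _ _ (2 * m)%:E).
  rewrite EFinM lee_pmul2l//; apply: ereal_inf_lbound.
  by exists lam', mu; split.
rewrite -EFinD lee_fin.
apply: le_trans m_le _.
have := support_fun_perturb lam (const_mx 1) calS_compact calS0 (ltW d0).
rewrite -/lam' -/phi1 => sf_le.
have d_le : d * phi1 <= e / 2.
  apply: (@le_trans _ _ (d * (`|phi1| + 1))).
    by rewrite ler_wpM2l ?ltW// (le_lt_trans (ler_norm _))// ltrDl.
  by rewrite /d invfM mulrA mulfVK ?gt_eqF.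
rewrite /objective; lra.
Qed.
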